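(* Let $p>1$ and $q>1$. Let $f\in C_0^2(\mathbb{R})$ and $g\in C_0^1(\mathbb{R})$ satisfy $\operatorname{supp} f,\ \operatorname{supp} g\subset\{x\in\mathbb{R}:|x|\le R\}$ for some $R\ge 1$. Consider the initial value problem \[ \begin{cases} u_{tt}-u_{xx}=|u_t|^p|u_x|^q & \text{in } \mathbb{R}\times(0,T),\\ u(x,0)=\varepsilon f(x),\quad u_t(x,0)=\varepsilon g(x), & x\in\mathbb{R}, \end{cases} \] with a parameter $\varepsilon>0$. Then there exist constants $\varepsilon_0=\varepsilon_0(f,g,p,q,R)>0$ and $c>0$ (independent of $\varepsilon$) such that for every $0<\varepsilon\le\varepsilon_0$, a classical solution $u\in C^2(\mathbb{R}\times[0,T])$ of this problem exists whenever $T\le c\,\varepsilon^{-(p+q-1)}$. In particular the lifespan satisfies $T(\varepsilon)\ge c\,\varepsilon^{-(p+q-1)}$ for $0<\varepsilon\le\varepsilon_0$.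
   Context: The lifespan $T(\varepsilon)$ is the supremum of all $T>0$ such that a classical solution of the problem exists on $\mathbb{R}\times[0,T]$ for the fixed data $(f,g)$. *)

(* Defs.v *)
From Stdlib Require Import Reals.
From Coquelicot Require Import Coquelicot.
Open Scope R_scope.

(* a^p for a >= 0 and real p > 0, with the convention 0^p = 0
   (Stdlib's Rpower 0 p is 1, so we guard the case a <= 0). *)
Definition nnpow (a p : R) : R :=
  if Rle_dec a 0 then 0 else Rpower a p.

Definition C1R (f : R -> R) : Prop :=
  forall x, ex_derive f x /\ continuous (Derive f) x.

Definition C2R (f : R -> R) : Prop :=
  forall x, ex_derive f x /\ ex_derive (Derive f) x /\
            continuous (Derive (Derive f)) x.

(* support contained in [-R0, R0] (closed set, so equivalent to supp f ⊂ [-R0,R0]) *)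
Definition supp_in (f : R -> R) (R0 : R) : Prop :=
  forall x, R0 < Rabs x -> f x = 0.

Definition dx (u : R -> R -> R) : R -> R -> R :=
  fun x t => Derive (fun y => u y t) x.
Definition dt (u : R -> R -> R) : R -> R -> R :=
  fun x t => Derive (fun s => u x s) t.

Definition jcont (v : R -> R -> R) (x t : R) : Prop :=
  continuous (fun z : R * R => v (fst z) (snd z)) (x, t).

Definition C2RR (u : R -> R -> R) : Prop :=
  forall x t,
    ex_derive (fun y => u y t) x /\ ex_derive (fun s => u x s) t /\
    ex_derive (fun y => dx u y t) x /\ ex_derive (fun s => dx u x s) t /\
    ex_derive (fun y => dt u y t) x /\ ex_derive (fun s => dt u x s) t /\
    jcont u x t /\ jcont (dx u) x t /\ jcont (dt u) x t /\
    jcont (dx (dx u)) x t /\ jcont (dt (dx u)) x t /\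
    jcont (dx (dt u)) x t /\ jcont (dt (dt u)) x t.

Definition classical_solution (p q eps : R) (f g : R -> R) (T : R)
    (u : R -> R -> R) : Prop :=
  C2RR u /\
  (forall x t, 0 < t < T ->
     dt (dt u) x t - dx (dx u) x t =
     nnpow (Rabs (dt u x t)) p * nnpow (Rabs (dx u x t)) q) /\
  (forall x, u x 0 = eps * f x) /\
  (forall x, dt u x 0 = eps * g x).

(* Main.v *)
(** The Riemann invariants [u_t + u_x] and [u_t - u_x] satisfy transport
    equations with the common source [H = |u_t|^p |u_x|^q], so the problem is a
    fixed-point equation for the scalar function [H]. With data of size
    [eps], the ball of radius [r ~ eps] is invariant and the map is a
    contraction in the sup norm as soon as [T * (p + q) * r^(p + q - 1) <= 1/2],
    which is the lifespan bound.
    Because [|a|^p |b|^q] is [C^1], the [x]-derivatives of the Picard iterates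
    also converge uniformly; the [t]-derivatives then follow from
    the transport equations. *)
Require Import Defs.
From Stdlib Require Import ssreflect Reals Lra Lia FunctionalExtensionality.
From Coquelicot Require Import Coquelicot.
Open Scope R_scope.

(** The source is sought among functions [H] that are jointly continuous and have a jointly
    continuous x-derivative [K]. In an integral along characteristics, t enters only through the
    position [x + sig * (t - s)] and the upper limit, so a t-derivative of the integral costs an
    x-derivative of [H] and never a t-derivative. The class is therefore stable under the iteration
    even though freezing time outside [0, T] destroys t-differentiability, and it is just enough for
    a C^2 solution on the whole plane.

    The obstacle is an exponent below 2: the derivative of |a|^p is then only Hölder continuous, so
    the differentiated iteration map need not be Lipschitz in [H]. It is, however, affine in [K],
    with the same factor 1/2 as the contraction for [H]. Being affine, it also bounds [K] without
    any new smallness condition, so the lifespan constant sees the sup norms of f' and g but not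
    those of f'' and g'. *)

(** * Joint continuity of functions of two variables *)

Lemma jcont_comp2 (H X Y : R -> R -> R) x t :
  (forall x t, jcont H x t) -> jcont X x t -> jcont Y x t ->
  jcont (fun x t => H (X x t) (Y x t)) x t.
Proof.
  intros hH hX hY.
  apply (continuous_comp_2 (fun z : R * R => X (fst z) (snd z))
           (fun z : R * R => Y (fst z) (snd z)) H); [exact hX | exact hY |].
  apply hH.
Qed.

Lemma jcont_comp1 (h : R -> R) (X : R -> R -> R) x t :
  (forall x, continuous h x) -> jcont X x t -> jcont (fun x t => h (X x t)) x t.
Proof.
  intros hh hX.
  apply (continuous_comp (fun z : R * R => X (fst z) (snd z)) h); [exact hX |].
  apply hh.
Qed.

Lemma jcont_fst x t : jcont (fun x _ => x) x t.
Proof. apply continuous_fst. Qed.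

Lemma jcont_snd x t : jcont (fun _ t => t) x t.
Proof. apply continuous_snd. Qed.

Lemma jcont_const c x t : jcont (fun _ _ => c) x t.
Proof. apply continuous_const. Qed.

Lemma jcont_plus (F G : R -> R -> R) x t :
  jcont F x t -> jcont G x t -> jcont (fun x t => F x t + G x t) x t.
Proof. intros; now apply: continuous_plus. Qed.

Lemma jcont_minus (F G : R -> R -> R) x t :
  jcont F x t -> jcont G x t -> jcont (fun x t => F x t - G x t) x t.
Proof. intros; now apply: continuous_minus. Qed.

Lemma jcont_mult (F G : R -> R -> R) x t :
  jcont F x t -> jcont G x t -> jcont (fun x t => F x t * G x t) x t.
Proof. intros; now apply: continuous_mult. Qed.

Ltac jc :=
  lazymatch goal with
  | |- jcont (fun x _ => x) _ _ => apply jcont_fst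
  | |- jcont (fun _ t => t) _ _ => apply jcont_snd
  | |- jcont (fun _ _ => ?c) _ _ => apply jcont_const
  | |- jcont (fun x t => @?F x t + @?G x t) _ _ => apply (jcont_plus F G); jc
  | |- jcont (fun x t => @?F x t - @?G x t) _ _ => apply (jcont_minus F G); jc
  | |- jcont (fun x t => @?F x t * @?G x t) _ _ => apply (jcont_mult F G); jc
  | |- _ => auto
  end.

Lemma jcont_section (F : R -> R -> R) (X Y : R -> R) s :
  (forall x t, jcont F x t) -> continuous X s -> continuous Y s ->
  continuous (fun s => F (X s) (Y s)) s.
Proof.
  intros hF hX hY. apply (continuous_comp_2 X Y F); auto. apply hF.
Qed.

Lemma jcont_2d (F : R -> R -> R) x t : jcont F x t <-> continuity_2d_pt F x t.
Proof. symmetry; apply continuity_2d_pt_filterlim. Qed.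

(** * Duhamel integrals along characteristics *)

(** Solution of [D_t - sig * D_x = H] with zero initial value. Slopes 1 and -1 serve the two
    families of characteristics; slope 0 is the plain time integral that recovers u from u_t. *)
Definition duhamel (sig : R) (H : R -> R -> R) (x t : R) : R :=
  RInt (fun s => H (x + sig * (t - s)) s) 0 t.

Lemma characteristic_continuous (sig : R) (H : R -> R -> R) x t s :
  (forall x t, jcont H x t) -> continuous (fun s => H (x + sig * (t - s)) s) s.
Proof.
  intros hH.
  apply (jcont_section H (fun s => x + sig * (t - s)) (fun s => s)); auto.
  - apply: ex_derive_continuous. auto_derive. exact I.
  - apply continuous_id.
Qed.

Lemma characteristic_ex_RInt (sig : R) (H : R -> R -> R) x t a b :
  (forall x t, jcont H x t) -> ex_RInt (fun s => H (x + sig * (t - s)) s) a b.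
Proof.
  intros hH. apply (ex_RInt_continuous (V := R_CompleteNormedModule)). intros z _.
  now apply characteristic_continuous.
Qed.

(** Moving t out of the upper limit leaves a parameter integral over the fixed interval [0, 1], to
    which uniform continuity applies directly. *)
Lemma duhamel_rescale (sig : R) (H : R -> R -> R) x t :
  (forall x t, jcont H x t) ->
  duhamel sig H x t = t * RInt (fun r => H (x + sig * (t - t * r)) (t * r)) 0 1.
Proof.
  intros hH. unfold duhamel.
  assert (E := RInt_comp_lin (fun s => H (x + sig * (t - s)) s) t 0 0 1).
  replace (t * 0 + 0) with 0 in E by ring.
  replace (t * 1 + 0) with t in E by ring.
  rewrite <- E by now apply characteristic_ex_RInt.
  rewrite RInt_scal.
  - apply (f_equal (Rmult t)). apply RInt_ext. intros r _.
    now replace (t * r + 0) with (t * r) by ring.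
  - apply (ex_RInt_ext (fun r => H (x + sig * (t - t * r)) (t * r))).
    { intros r _. now replace (t * r + 0) with (t * r) by ring. }
    apply (ex_RInt_continuous (V := R_CompleteNormedModule)). intros r _.
    apply (jcont_section H (fun r => x + sig * (t - t * r)) (fun r => t * r)); auto;
    apply: ex_derive_continuous; auto_derive; exact I.
Qed.


Lemma duhamel_jcont (sig : R) (H : R -> R -> R) :
  (forall x t, jcont H x t) -> forall x t, jcont (duhamel sig H) x t.
Proof.
  intros hH x0 t0.
  assert (hJ : jcont (fun x t => RInt (fun r => H (x + sig * (t - t * r)) (t * r)) 0 1) x0 t0).
  { assert (hi : forall x t, ex_RInt (fun r => H (x + sig * (t - t * r)) (t * r)) 0 1).
    { intros x t. apply (ex_RInt_continuous (V := R_CompleteNormedModule)). intros r _.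
      apply (jcont_section H (fun r => x + sig * (t - t * r)) (fun r => t * r)); auto;
      apply: ex_derive_continuous; auto_derive; exact I. }
    apply jcont_2d. intros eps.
    (* This box contains the whole rescaled path of every (x, t) whose coordinates are within 1 of
       those of (x0, t0). *)
    set (A := Rabs x0 + 1 + Rabs sig * (Rabs t0 + 1)). set (B := Rabs t0 + 1).
    destruct (uniform_continuity_2d H (-A) A (-B) B
                (fun x y _ _ => proj1 (jcont_2d H x y) (hH x y)) (pos_div_2 eps))
      as [d hd].
    assert (hs := Rabs_pos sig).
    (* The bound 1 keeps the paths in the box; a change of (x, t) by less than [e] moves each path
       point by less than [e * (1 + Rabs sig)]. *)
    set (e := Rmin 1 (d / (1 + Rabs sig))).
    assert (he : 0 < e).
    { apply Rmin_pos; [lra|]. apply Rdiv_lt_0_compat; [apply cond_pos | lra]. }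
    assert (he1 : e <= 1) by apply Rmin_l.
    assert (he2 : e * (1 + Rabs sig) <= d).
    { apply Rle_div_r; [lra|]. apply Rmin_r. }
    exists (mkposreal e he). intros x t hx ht. simpl in hx, ht.
    rewrite <- (RInt_minus (V := R_CompleteNormedModule)); [| apply hi | apply hi].
    apply Rle_lt_trans with ((1 - 0) * (eps / 2)); [| destruct eps; simpl; lra].
    apply abs_RInt_le_const; [lra | apply: ex_RInt_minus; apply hi |].
    intros r hr. apply Rlt_le.
    assert (bnd : forall y s, Rabs (y - x0) <= 1 -> Rabs (s - t0) <= 1 ->
              (- A <= y + sig * (s - s * r) <= A) /\ (- B <= s * r <= B)).
    { intros y s hy hs'.
      assert (Rabs y <= Rabs x0 + 1).
      { replace y with (x0 + (y - x0)) by ring.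
        eapply Rle_trans; [apply Rabs_triang|]. lra. }
      assert (h1 : Rabs s <= B).
      { unfold B. replace s with (t0 + (s - t0)) by ring.
        eapply Rle_trans; [apply Rabs_triang|]. lra. }
      assert (h2 : Rabs (s * r) <= B).
      { rewrite Rabs_mult. rewrite -> (Rabs_pos_eq r) by lra. assert (h0 := Rabs_pos s). nra. }
      assert (h3 : Rabs (s - s * r) <= B).
      { replace (s - s * r) with (s * (1 - r)) by ring.
        rewrite Rabs_mult. rewrite -> (Rabs_pos_eq (1 - r)) by lra. assert (h0 := Rabs_pos s). nra. }
      split; apply Rabs_le_between; auto.
      eapply Rle_trans; [apply Rabs_triang|]. rewrite Rabs_mult. unfold A. fold B. nra. }
    assert (bx := bnd x t ltac:(lra) ltac:(lra)).
    assert (b0 := bnd x0 t0 ltac:(rewrite Rminus_diag; rewrite Rabs_R0; lra)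
                  ltac:(rewrite Rminus_diag; rewrite Rabs_R0; lra)).
    apply hd; try tauto.
    - replace (x + sig * (t - t * r) - (x0 + sig * (t0 - t0 * r)))
        with ((x - x0) + sig * ((t - t0) * (1 - r))) by ring.
      eapply Rle_lt_trans; [apply Rabs_triang|].
      rewrite !Rabs_mult. rewrite -> (Rabs_pos_eq (1 - r)) by lra.
      assert (h0 := Rabs_pos (t - t0)).
      assert (Rabs (t - t0) * (1 - r) <= e) by nra.
      nra.
    - replace (t * r - t0 * r) with ((t - t0) * r) by ring.
      rewrite Rabs_mult. rewrite -> (Rabs_pos_eq r) by lra.
      assert (h0 := Rabs_pos (t - t0)). nra. }
  apply (continuous_ext (fun z : R * R => snd z *
    (fun x t => RInt (fun r => H (x + sig * (t - t * r)) (t * r)) 0 1) (fst z) (snd z))).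
  { intros [x t]; simpl. symmetry. now apply duhamel_rescale. }
  apply (jcont_mult (fun _ t => t)
    (fun x t => RInt (fun r => H (x + sig * (t - t * r)) (t * r)) 0 1)); auto.
  apply jcont_snd.
Qed.

Lemma duhamel_is_derive_x (sig : R) (H K : R -> R -> R) x t :
  (forall x t, jcont H x t) -> (forall x t, jcont K x t) ->
  (forall x t, is_derive (fun y => H y t) x (K x t)) ->
  is_derive (fun y => duhamel sig H y t) x (duhamel sig K x t).
Proof.
  intros hH hK hd.
  assert (hd' : forall y s, is_derive (fun u => H (u + sig * (t - s)) s) y (K (y + sig * (t - s)) s)).
  { intros y s. evar_last.
    - apply (is_derive_comp (fun u => H u s) (fun u => u + sig * (t - s))).
      + apply hd.
      + auto_derive; [exact I | reflexivity].
    - apply Rmult_1_l. }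
  unfold duhamel at 2.
  rewrite (RInt_ext _ (fun s => Derive (fun u => H (u + sig * (t - s)) s) x)).
  2:{ intros s _. symmetry. apply is_derive_unique, hd'. }
  apply (is_derive_RInt_param (fun u s => H (u + sig * (t - s)) s)).
  - apply filter_forall. intros y s _. eexists. apply hd'.
  - intros s _.
    apply (continuity_2d_pt_ext (fun u v => K (u + sig * (t - v)) v)).
    { intros u v. symmetry. apply is_derive_unique, hd'. }
    apply jcont_2d. apply (jcont_comp2 K (fun u v => u + sig * (t - v)) (fun u v => v));
      [exact hK | jc | jc].
  - apply filter_forall. intros y. now apply characteristic_ex_RInt.
Qed.

(** Leibniz's rule: the moving upper limit contributes [H] at s = t, where the characteristic passes
    through x, and the integrand contributes [sig] times its x-derivative. *)
Lemma duhamel_is_derive_t (sig : R) (H K : R -> R -> R) x t :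
  (forall x t, jcont H x t) -> (forall x t, jcont K x t) ->
  (forall x t, is_derive (fun y => H y t) x (K x t)) ->
  is_derive (fun s => duhamel sig H x s) t (H x t + sig * duhamel sig K x t).
Proof.
  intros hH hK hd.
  assert (hd' : forall r s, is_derive (fun u => H (x + sig * (u - s)) s) r
            (sig * K (x + sig * (r - s)) s)).
  { intros y s.
    apply (is_derive_comp (fun u => H u s) (fun u => x + sig * (u - s))).
    + apply hd.
    + auto_derive; [exact I | ring]. }
  assert (hc : forall r s, continuity_2d_pt (fun u v => Derive (fun z => H (x + sig * (z - v)) v) u) r s).
  { intros r s.
    apply (continuity_2d_pt_ext (fun u v => sig * K (x + sig * (u - v)) v)).
    { intros u v. symmetry. apply is_derive_unique, hd'. }
    apply jcont_2d. apply jcont_mult; [apply jcont_const|].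
    apply (jcont_comp2 K (fun u v => x + sig * (u - v)) (fun u v => v));
      [exact hK | jc | jc]. }
  assert (hcs : forall r s, continuity_pt (fun v => H (x + sig * (r - v)) v) s).
  { intros r s. apply continuity_pt_filterlim.
    apply (characteristic_continuous sig H x r s hH). }
  evar_last.
  - unfold duhamel.
    apply (is_derive_RInt_param_bound_comp (fun r s => H (x + sig * (r - s)) s)
             (fun _ => 0) (fun r => r) t 0 1).
    + apply filter_forall. intros y. now apply characteristic_ex_RInt.
    + exists (mkposreal 1 Rlt_0_1). apply filter_forall. intros y. now apply characteristic_ex_RInt.
    + exists (mkposreal 1 Rlt_0_1). apply filter_forall. intros y. now apply characteristic_ex_RInt.
    + apply: is_derive_const.
    + apply: is_derive_id.
    + exists (mkposreal 1 Rlt_0_1). apply filter_forall. intros y s _. eexists. apply hd'.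
    + intros s _. apply hc.
    + apply locally_2d_forall. intros; apply hc.
    + apply locally_2d_forall. intros; apply hc.
    + apply hcs.
    + apply hcs.
  - simpl. rewrite (RInt_ext _ (fun s => scal sig (K (x + sig * (t - s)) s))).
    2:{ intros s _. apply is_derive_unique, hd'. }
    rewrite -> (RInt_scal (V := R_CompleteNormedModule) (fun s => K (x + sig * (t - s)) s))
      by now apply characteristic_ex_RInt.
    unfold duhamel, scal; simpl; unfold mult; simpl.
    replace (x + sig * (t - t)) with x by ring. ring.
Qed.

Lemma duhamel_minus_bound (sig : R) (H H' : R -> R -> R) (T e x t : R) :
  (forall x t, jcont H x t) -> (forall x t, jcont H' x t) ->
  (forall x t, Rabs (H x t - H' x t) <= e) -> 0 <= t <= T ->
  Rabs (duhamel sig H x t - duhamel sig H' x t) <= T * e.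
Proof.
  intros hH hH' he ht. unfold duhamel.
  rewrite <- (RInt_minus (V := R_CompleteNormedModule)); [| now apply characteristic_ex_RInt ..].
  assert (0 <= e) by (eapply Rle_trans; [apply Rabs_pos | apply (he 0 0)]).
  apply Rle_trans with ((t - 0) * e); [| nra].
  apply abs_RInt_le_const; [lra | apply: ex_RInt_minus; now apply characteristic_ex_RInt |].
  intros s _. apply he.
Qed.

Lemma duhamel_zero sig x t : duhamel sig (fun _ _ => 0) x t = 0.
Proof. unfold duhamel. rewrite RInt_const. apply Rmult_0_r. Qed.

Lemma duhamel_at_0 sig H x : duhamel sig H x 0 = 0.
Proof. apply: RInt_point. Qed.

Lemma duhamel_bound (sig : R) (H : R -> R -> R) (T B x t : R) :
  (forall x t, jcont H x t) -> (forall x t, Rabs (H x t) <= B) -> 0 <= t <= T ->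
  Rabs (duhamel sig H x t) <= T * B.
Proof.
  intros hH hB ht.
  replace (duhamel sig H x t) with (duhamel sig H x t - duhamel sig (fun _ _ => 0) x t)
    by (rewrite duhamel_zero; ring).
  apply duhamel_minus_bound; auto.
  - intros; apply jcont_const.
  - intros y s. now rewrite Rminus_0_r.
Qed.

(** * Uniform limits *)

Lemma uniform_cauchy_limit (F : nat -> R -> R -> R) :
  (forall e, 0 < e -> exists N, forall n m, (N <= n)%nat -> (N <= m)%nat ->
     forall x t, Rabs (F n x t - F m x t) <= e) ->
  exists G : R -> R -> R, forall e, 0 < e -> exists N, forall n, (N <= n)%nat ->
     forall x t, Rabs (F n x t - G x t) <= e.
Proof.
  intros hF.
  assert (hC : forall x t, Cauchy_crit (fun n => F n x t)).
  { intros x t e he. destruct (hF (e / 2)) as [N hN]; [lra|].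
    exists N. intros n m hn hm. unfold Rdist.
    assert (h := hN n m hn hm x t). lra. }
  exists (fun x t => proj1_sig (Rcomplete.R_complete _ (hC x t))).
  intros e he. destruct (hF (e / 2)) as [N hN]; [lra|].
  exists N. intros n hn x t.
  destruct (Rcomplete.R_complete _ (hC x t)) as [l hl]; simpl.
  destruct (hl (e / 2)) as [M hM]; [lra|].
  (* [m] depends on the point (x, t), but [N] does not, so the resulting bound is uniform. *)
  set (m := Nat.max N M).
  assert (h1 := hN n m hn ltac:(lia) x t).
  assert (h2 := hM m ltac:(lia)). unfold Rdist in h2.
  replace (F n x t - l) with ((F n x t - F m x t) + (F m x t - l)) by ring.
  eapply Rle_trans; [apply Rabs_triang|]. lra.
Qed.

Lemma uniform_limit_jcont (F : nat -> R -> R -> R) (G : R -> R -> R) :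
  (forall n x t, jcont (F n) x t) ->
  (forall e, 0 < e -> exists N, forall n, (N <= n)%nat ->
     forall x t, Rabs (F n x t - G x t) <= e) ->
  forall x t, jcont G x t.
Proof.
  intros hc hu x t. apply jcont_2d. intros e.
  destruct (hu (e / 4)) as [N hN]; [destruct e; simpl; lra|].
  destruct (proj1 (jcont_2d _ _ _) (hc N x t) (pos_div_2 e)) as [d hd].
  exists d. intros y s hy hs.
  assert (h1 := hd y s hy hs). simpl in h1.
  assert (h2 := hN N ltac:(lia) y s). assert (h3 := hN N ltac:(lia) x t).
  apply Rabs_le_between in h2. apply Rabs_le_between in h3.
  apply Rabs_lt_between in h1. apply Rabs_lt_between. lra.
Qed.

Lemma uniform_limit_is_derive (F F' : nat -> R -> R -> R) (G G' : R -> R -> R) :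
  (forall n x t, is_derive (fun y => F n y t) x (F' n x t)) ->
  (forall e, 0 < e -> exists N, forall n, (N <= n)%nat ->
     forall x t, Rabs (F n x t - G x t) <= e) ->
  (forall e, 0 < e -> exists N, forall n, (N <= n)%nat ->
     forall x t, Rabs (F' n x t - G' x t) <= e) ->
  forall x t, is_derive (fun y => G y t) x (G' x t).
Proof.
  intros hd hu hu' x t. apply is_derive_Reals.
  apply (CVU_derivable (fun n y => F n y t) (fun n y => F' n y t)
           (fun y => G y t) (fun y => G' y t) x (mkposreal 1 Rlt_0_1)).
  - intros e he. destruct (hu' (e / 2)) as [N hN]; [lra|].
    exists N. intros n y hn _. rewrite Rabs_minus_sym.
    assert (h := hN n hn y t). lra.
  - intros y _ e he. destruct (hu (e / 2)) as [N hN]; [lra|].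
    exists N. intros n hn. unfold Rdist. assert (h := hN n hn y t). lra.
  - intros n y _. apply is_derive_Reals, hd.
  - unfold Boule. rewrite Rminus_diag. rewrite Rabs_R0. simpl. lra.
Qed.

(** * Elementary estimates and truncation of time *)

Lemma half_pow_small (C e : R) : 0 < e -> exists k, C * (1 / 2) ^ k <= e.
Proof.
  intros he.
  destruct (pow_lt_1_zero (1 / 2) ltac:(rewrite Rabs_pos_eq; lra) (e / (Rabs C + 1))) as [k hk].
  { apply Rdiv_lt_0_compat; [lra|]. assert (h := Rabs_pos C). lra. }
  exists k. assert (h := hk k ltac:(lia)).
  assert (hC := Rabs_pos C). assert (hC' := Rle_abs C).
  assert (hp : 0 < (1 / 2) ^ k) by (apply pow_lt; lra).
  rewrite -> Rabs_pos_eq in h by lra.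
  apply Rlt_div_r in h; [|lra]. nra.
Qed.

Lemma lipschitz_of_derive_bound (h dh : R -> R) (C r a b : R) :
  (forall x, is_derive h x (dh x)) ->
  (forall x, Rabs x <= r -> Rabs (dh x) <= C) ->
  Rabs a <= r -> Rabs b <= r -> Rabs (h a - h b) <= C * Rabs (a - b).
Proof.
  intros hd hC ha hb.
  destruct (MVT_gen h b a dh) as [c [hc ->]].
  - intros; apply hd.
  - intros x _. apply continuity_pt_filterlim. apply: ex_derive_continuous. eexists; apply hd.
  - rewrite Rabs_mult. apply Rmult_le_compat_r; [apply Rabs_pos|]. apply hC.
    apply Rabs_le_between in ha. apply Rabs_le_between in hb. apply Rabs_le_between.
    assert (h1 := Rmin_glb a b (- r) ltac:(lra) ltac:(lra)).
    assert (h2 := Rmax_lub a b r ltac:(lra) ltac:(lra)).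
    rewrite -> Rmin_comm in h1. rewrite -> Rmax_comm in h2. lra.
Qed.

Definition clamp (T t : R) : R := Rmax 0 (Rmin t T).

Lemma clamp_range T t : 0 <= T -> 0 <= clamp T t <= T.
Proof.
  intros hT. split; [apply Rmax_l|]. apply Rmax_lub; [lra | apply Rmin_r].
Qed.

Lemma clamp_id T t : 0 <= t <= T -> clamp T t = t.
Proof.
  intros ht. unfold clamp. rewrite Rmin_left; [|lra]. apply Rmax_right; lra.
Qed.

Lemma continuous_clamp T t : continuous (clamp T) t.
Proof.
  unfold clamp.
  (* Min and max of a and b are (a + b - |a - b|) / 2 and (a + b + |a - b|) / 2, so only continuity
     of the absolute value is needed. *)
  apply (continuous_ext (fun t => (0 + (t + T - Rabs (t - T)) / 2
    + Rabs ((t + T - Rabs (t - T)) / 2 - 0)) / 2)).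
  { intros s.
    replace ((s + T - Rabs (s - T)) / 2) with (Rmin s T).
    2:{ unfold Rmin, Rabs. destruct (Rle_dec s T), (Rcase_abs (s - T)); lra. }
    unfold Rmax, Rabs. destruct (Rle_dec 0 (Rmin s T)), (Rcase_abs (Rmin s T - 0)); lra. }
  assert (hm : continuous (fun t => (t + T - Rabs (t - T)) / 2) t).
  { apply: continuous_mult; [|apply continuous_const].
    apply: continuous_minus.
    - apply: continuous_plus; [apply continuous_id | apply continuous_const].
    - apply (continuous_comp (fun t => t - T) Rabs); [|apply continuous_Rabs].
      apply: continuous_minus; [apply continuous_id | apply continuous_const]. }
  apply: continuous_mult; [|apply continuous_const].
  apply: continuous_plus.
  - apply: continuous_plus; [apply continuous_const | exact hm].
  - apply (continuous_comp (fun t => (t + T - Rabs (t - T)) / 2 - 0) Rabs); [|apply continuous_Rabs].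
    apply: continuous_minus; [exact hm | apply continuous_const].
Qed.

(** * Riemann invariants *)

(* [wave 1 wl H] and [wave (-1) wr H] are [u_t + u_x] and [u_t - u_x] for
   [u_tt - u_xx = H], with initial values [wl] and [wr]. *)
Definition wave (sig : R) (w : R -> R) (H : R -> R -> R) (x t : R) : R :=
  w (x + sig * t) + duhamel sig H x t.

(** Half-sum and, below, half-difference of the invariants: the candidates for u_t and u_x. That
    they are derivatives of one function is shown only in [solution_of_source]. *)
Definition vt (wl wr : R -> R) (H : R -> R -> R) (x t : R) : R :=
  (wave 1 wl H x t + wave (-1) wr H x t) / 2.

Definition vx (wl wr : R -> R) (H : R -> R -> R) (x t : R) : R :=
  (wave 1 wl H x t - wave (-1) wr H x t) / 2.

Lemma wave_jcont sig w H :
  (forall x, continuous w x) -> (forall x t, jcont H x t) ->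
  forall x t, jcont (wave sig w H) x t.
Proof.
  intros hw hH x t. unfold wave.
  apply (jcont_plus (fun x t => w (x + sig * t))).
  - apply (jcont_comp1 w (fun x t => x + sig * t)); [auto | jc].
  - now apply duhamel_jcont.
Qed.

Lemma vt_jcont wl wr H :
  (forall x, continuous wl x) -> (forall x, continuous wr x) ->
  (forall x t, jcont H x t) -> forall x t, jcont (vt wl wr H) x t.
Proof.
  intros h1 h2 hH x t. unfold vt.
  apply (jcont_mult (fun x t => wave 1 wl H x t + wave (-1) wr H x t) (fun _ _ => / 2));
    [|apply jcont_const].
  apply (jcont_plus (wave 1 wl H) (wave (-1) wr H)); now apply wave_jcont.
Qed.

Lemma vx_jcont wl wr H :
  (forall x, continuous wl x) -> (forall x, continuous wr x) ->
  (forall x t, jcont H x t) -> forall x t, jcont (vx wl wr H) x t.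
Proof.
  intros h1 h2 hH x t. unfold vx.
  apply (jcont_mult (fun x t => wave 1 wl H x t - wave (-1) wr H x t) (fun _ _ => / 2));
    [|apply jcont_const].
  apply (jcont_minus (wave 1 wl H) (wave (-1) wr H)); now apply wave_jcont.
Qed.

Lemma wave_is_derive_x sig w dw H K x t :
  (forall x, is_derive w x (dw x)) ->
  (forall x t, jcont H x t) -> (forall x t, jcont K x t) ->
  (forall x t, is_derive (fun y => H y t) x (K x t)) ->
  is_derive (fun y => wave sig w H y t) x (wave sig dw K x t).
Proof.
  intros hw hH hK hd. unfold wave. apply: is_derive_plus.
  - evar_last.
    + apply (is_derive_comp w (fun y => y + sig * t)); [apply hw|].
      auto_derive; [exact I | reflexivity].
    + apply Rmult_1_l.
  - now apply duhamel_is_derive_x.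
Qed.

Lemma wave_is_derive_t sig w dw H K x t :
  (forall x, is_derive w x (dw x)) ->
  (forall x t, jcont H x t) -> (forall x t, jcont K x t) ->
  (forall x t, is_derive (fun y => H y t) x (K x t)) ->
  is_derive (fun s => wave sig w H x s) t (H x t + sig * wave sig dw K x t).
Proof.
  intros hw hH hK hd. unfold wave. evar_last.
  - apply: is_derive_plus.
    + apply (is_derive_comp w (fun s => x + sig * s)); [apply hw|].
      auto_derive; [exact I | reflexivity].
    + now apply (duhamel_is_derive_t sig H K).
  - rewrite /plus /scal /=. rewrite /mult /=. ring.
Qed.

Lemma half_eq (a : R) : a / 2 = scal (/ 2) a.
Proof. rewrite /scal /= /mult /=. field. Qed.

Lemma vt_is_derive_x wl wr dwl dwr H K x t :
  (forall x, is_derive wl x (dwl x)) -> (forall x, is_derive wr x (dwr x)) ->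
  (forall x t, jcont H x t) -> (forall x t, jcont K x t) ->
  (forall x t, is_derive (fun y => H y t) x (K x t)) ->
  is_derive (fun y => vt wl wr H y t) x (vt dwl dwr K x t).
Proof.
  intros h1 h2 hH hK hd. unfold vt.
  apply (is_derive_ext (fun y => scal (/ 2) (wave 1 wl H y t + wave (-1) wr H y t))).
  { intros y. symmetry. apply half_eq. }
  rewrite half_eq. apply is_derive_scal. apply: is_derive_plus; now apply wave_is_derive_x.
Qed.

Lemma vx_is_derive_x wl wr dwl dwr H K x t :
  (forall x, is_derive wl x (dwl x)) -> (forall x, is_derive wr x (dwr x)) ->
  (forall x t, jcont H x t) -> (forall x t, jcont K x t) ->
  (forall x t, is_derive (fun y => H y t) x (K x t)) ->
  is_derive (fun y => vx wl wr H y t) x (vx dwl dwr K x t).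
Proof.
  intros h1 h2 hH hK hd. unfold vx.
  apply (is_derive_ext (fun y => scal (/ 2) (wave 1 wl H y t - wave (-1) wr H y t))).
  { intros y. symmetry. apply half_eq. }
  rewrite half_eq. apply is_derive_scal. apply: is_derive_minus; now apply wave_is_derive_x.
Qed.

(** This is the equation u_tt = H + u_xx: the opposite slopes turn the half-sum of the
    differentiated waves into their half-difference. *)
Lemma vt_is_derive_t wl wr dwl dwr H K x t :
  (forall x, is_derive wl x (dwl x)) -> (forall x, is_derive wr x (dwr x)) ->
  (forall x t, jcont H x t) -> (forall x t, jcont K x t) ->
  (forall x t, is_derive (fun y => H y t) x (K x t)) ->
  is_derive (fun s => vt wl wr H x s) t (H x t + vx dwl dwr K x t).
Proof.
  intros h1 h2 hH hK hd. unfold vt.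
  apply (is_derive_ext (fun s => scal (/ 2) (wave 1 wl H x s + wave (-1) wr H x s))).
  { intros y. symmetry. apply half_eq. }
  evar_last.
  - apply is_derive_scal. apply: is_derive_plus;
      [now apply (wave_is_derive_t 1 wl dwl H K) | now apply (wave_is_derive_t (-1) wr dwr H K)].
  - rewrite /vx /scal /= /plus /= /mult /=. field.
Qed.

(** The common source cancels in the difference. What remains is the compatibility condition between
    u_xt and u_tx, which makes [vt] and [vx] integrable to a single u. *)
Lemma vx_is_derive_t wl wr dwl dwr H K x t :
  (forall x, is_derive wl x (dwl x)) -> (forall x, is_derive wr x (dwr x)) ->
  (forall x t, jcont H x t) -> (forall x t, jcont K x t) ->
  (forall x t, is_derive (fun y => H y t) x (K x t)) ->
  is_derive (fun s => vx wl wr H x s) t (vt dwl dwr K x t).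
Proof.
  intros h1 h2 hH hK hd. unfold vx.
  apply (is_derive_ext (fun s => scal (/ 2) (wave 1 wl H x s - wave (-1) wr H x s))).
  { intros y. symmetry. apply half_eq. }
  evar_last.
  - apply is_derive_scal. apply: is_derive_minus;
      [now apply (wave_is_derive_t 1 wl dwl H K) | now apply (wave_is_derive_t (-1) wr dwr H K)].
  - rewrite /vt /scal /= /minus /= /plus /= /opp /= /mult /=. field.
Qed.

Lemma wave_bound sig w H (T M B x t : R) :
  (forall x t, jcont H x t) -> (forall x, Rabs (w x) <= M) ->
  (forall x t, Rabs (H x t) <= B) -> 0 <= t <= T ->
  Rabs (wave sig w H x t) <= M + T * B.
Proof.
  intros hH hw hB ht. unfold wave. eapply Rle_trans; [apply Rabs_triang|].
  apply Rplus_le_compat; [apply hw | now apply duhamel_bound].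
Qed.

Lemma vt_vx_bound wl wr H (T M B x t : R) :
  (forall x t, jcont H x t) ->
  (forall x, Rabs (wl x) <= M) -> (forall x, Rabs (wr x) <= M) ->
  (forall x t, Rabs (H x t) <= B) -> 0 <= t <= T ->
  Rabs (vt wl wr H x t) <= M + T * B /\ Rabs (vx wl wr H x t) <= M + T * B.
Proof.
  intros hH h1 h2 hB ht.
  assert (b1 := wave_bound 1 wl H T M B x t hH h1 hB ht).
  assert (b2 := wave_bound (-1) wr H T M B x t hH h2 hB ht).
  unfold vt, vx. apply Rabs_le_between in b1. apply Rabs_le_between in b2.
  split; apply Rabs_le_between; lra.
Qed.

Lemma vt_vx_minus_bound wl wr H H' (T e x t : R) :
  (forall x t, jcont H x t) -> (forall x t, jcont H' x t) ->
  (forall x t, Rabs (H x t - H' x t) <= e) -> 0 <= t <= T ->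
  Rabs (vt wl wr H x t - vt wl wr H' x t) <= T * e /\
  Rabs (vx wl wr H x t - vx wl wr H' x t) <= T * e.
Proof.
  intros hH hH' he ht.
  assert (b1 := duhamel_minus_bound 1 H H' T e x t hH hH' he ht).
  assert (b2 := duhamel_minus_bound (-1) H H' T e x t hH hH' he ht).
  unfold vt, vx, wave. apply Rabs_le_between in b1. apply Rabs_le_between in b2.
  split; apply Rabs_le_between; lra.
Qed.

(** * Picard iteration on the source *)

Section Picard.

(** [phi] and [psi] stand for |.|^p and |.|^q; only their C^1 regularity and bounds on [-r, r]
    enter. [D0] bounds the derivatives of the initial invariants and is absent from the smallness
    condition [hTsmall]. *)
Variables (phi dphi psi dpsi wl wr dwl dwr : R -> R).
Variables (A A' B B' r T D0 : R).
Hypothesis hphi : forall x, is_derive phi x (dphi x).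
Hypothesis hpsi : forall x, is_derive psi x (dpsi x).
Hypothesis hdphi : forall x, continuous dphi x.
Hypothesis hdpsi : forall x, continuous dpsi x.
Hypothesis hA : forall x, Rabs x <= r -> Rabs (phi x) <= A.
Hypothesis hA' : forall x, Rabs x <= r -> Rabs (dphi x) <= A'.
Hypothesis hB : forall x, Rabs x <= r -> Rabs (psi x) <= B.
Hypothesis hB' : forall x, Rabs x <= r -> Rabs (dpsi x) <= B'.
Hypothesis hwl : forall x, is_derive wl x (dwl x).
Hypothesis hwr : forall x, is_derive wr x (dwr x).
Hypothesis hdwl : forall x, continuous dwl x.
Hypothesis hdwr : forall x, continuous dwr x.
Hypothesis hwlr : forall x, Rabs (wl x) <= r / 2.
Hypothesis hwrr : forall x, Rabs (wr x) <= r / 2.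
Hypothesis hdwlD : forall x, Rabs (dwl x) <= D0.
Hypothesis hdwrD : forall x, Rabs (dwr x) <= D0.
Hypothesis hT : 0 <= T.
Hypothesis hAB : A * B <= r * (A' * B + A * B').
Hypothesis hTsmall : T * (A' * B + A * B') <= 1 / 2.

Let r_pos : 0 <= r.
Proof. assert (h := hwlr 0). assert (h' := Rabs_pos (wl 0)). lra. Qed.
Let A_pos : 0 <= A.
Proof. eapply Rle_trans; [apply Rabs_pos|]. apply (hA 0). now rewrite Rabs_R0. Qed.
Let A'_pos : 0 <= A'.
Proof. eapply Rle_trans; [apply Rabs_pos|]. apply (hA' 0). now rewrite Rabs_R0. Qed.
Let B_pos : 0 <= B.
Proof. eapply Rle_trans; [apply Rabs_pos|]. apply (hB 0). now rewrite Rabs_R0. Qed.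
Let B'_pos : 0 <= B'.
Proof. eapply Rle_trans; [apply Rabs_pos|]. apply (hB' 0). now rewrite Rabs_R0. Qed.
Let D0_pos : 0 <= D0.
Proof. eapply Rle_trans; [apply Rabs_pos|]. apply (hdwlD 0). Qed.
Let continuous_of_derive (h dh : R -> R) (hd : forall x, is_derive h x (dh x)) x : continuous h x.
Proof. apply: ex_derive_continuous. eexists. apply hd. Qed.

(** Lipschitz constant of the product [phi a * psi b] on the square |a|, |b| <= r, in the max
    norm. *)
Let Lam := A' * B + A * B'.

(* Freezing the time of the right-hand side outside [0, T] makes all bounds
   on [0, T] global and gives a solution defined on the whole plane. *)
Definition source (H : R -> R -> R) (x t : R) : R :=
  phi (vt wl wr H x (clamp T t)) * psi (vx wl wr H x (clamp T t)).

(** The chain rule applied to [source], with [K] in the place of the x-derivative of [H]. For fixed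
    [H] it is affine in [K]. *)
Definition dsource (H K : R -> R -> R) (x t : R) : R :=
  dphi (vt wl wr H x (clamp T t)) * psi (vx wl wr H x (clamp T t))
    * vt dwl dwr K x (clamp T t)
  + phi (vt wl wr H x (clamp T t)) * dpsi (vx wl wr H x (clamp T t))
    * vx dwl dwr K x (clamp T t).

(** The bound on [K] reproduces itself: it gives differentiated velocities of size at most D0 + T *
    2 * Lam * D0 <= 2 * D0, and [dsource] multiplies these by at most [Lam]. *)
Definition admissible (H K : R -> R -> R) : Prop :=
  (forall x t, jcont H x t) /\ (forall x t, jcont K x t) /\
  (forall x t, is_derive (fun y => H y t) x (K x t)) /\
  (forall x t, Rabs (H x t) <= A * B) /\
  (forall x t, Rabs (K x t) <= 2 * Lam * D0).

(** The data use half of the radius. The Duhamel term uses at most the other half, since T * A * B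
    <= r * (T * Lam) <= r / 2 by [hAB] and [hTsmall]. *)
Lemma velocity_bound H x t :
  (forall x t, jcont H x t) -> (forall x t, Rabs (H x t) <= A * B) ->
  Rabs (vt wl wr H x (clamp T t)) <= r /\ Rabs (vx wl wr H x (clamp T t)) <= r.
Proof.
  intros hH hb.
  destruct (vt_vx_bound wl wr H T (r / 2) (A * B) x (clamp T t) hH hwlr hwrr hb
              (clamp_range T t hT)) as [h1 h2].
  assert (T * (A * B) <= T * (r * Lam)) by (apply Rmult_le_compat_l; auto).
  assert (r * (T * Lam) <= r * (1 / 2)) by (apply Rmult_le_compat_l; auto).
  split; lra.
Qed.

Lemma dvelocity_bound K x t :
  (forall x t, jcont K x t) -> (forall x t, Rabs (K x t) <= 2 * Lam * D0) ->
  Rabs (vt dwl dwr K x (clamp T t)) <= 2 * D0 /\ Rabs (vx dwl dwr K x (clamp T t)) <= 2 * D0.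
Proof.
  intros hK hb.
  destruct (vt_vx_bound dwl dwr K T D0 (2 * Lam * D0) x (clamp T t) hK hdwlD hdwrD hb
              (clamp_range T t hT)) as [h1 h2].
  assert (2 * D0 * (T * Lam) <= 2 * D0 * (1 / 2)) by (apply Rmult_le_compat_l; [lra | auto]).
  split; lra.
Qed.

Lemma source_jcont H : (forall x t, jcont H x t) -> forall x t, jcont (source H) x t.
Proof.
  intros hH x t. unfold source.
  assert (hc : jcont (fun _ t => clamp T t) x t).
  { apply (jcont_comp1 (clamp T) (fun _ t => t)); [apply continuous_clamp | apply jcont_snd]. }
  apply (jcont_mult (fun x t => phi (vt wl wr H x (clamp T t)))
                    (fun x t => psi (vx wl wr H x (clamp T t)))).
  - apply (jcont_comp1 phi (fun x t => vt wl wr H x (clamp T t))); [eauto|].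
    apply (jcont_comp2 (vt wl wr H) (fun x _ => x) (fun _ t => clamp T t));
      [apply vt_jcont; eauto | apply jcont_fst | exact hc].
  - apply (jcont_comp1 psi (fun x t => vx wl wr H x (clamp T t))); [eauto|].
    apply (jcont_comp2 (vx wl wr H) (fun x _ => x) (fun _ t => clamp T t));
      [apply vx_jcont; eauto | apply jcont_fst | exact hc].
Qed.

Lemma dsource_jcont H K :
  (forall x t, jcont H x t) -> (forall x t, jcont K x t) -> forall x t, jcont (dsource H K) x t.
Proof.
  intros hH hK x t. unfold dsource.
  assert (hc : jcont (fun _ t => clamp T t) x t).
  { apply (jcont_comp1 (clamp T) (fun _ t => t)); [apply continuous_clamp | apply jcont_snd]. }
  assert (hF : forall F, (forall x t, jcont F x t) -> jcont (fun x t => F x (clamp T t)) x t).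
  { intros F hF.
    apply (jcont_comp2 F (fun x _ => x) (fun _ t => clamp T t)); [auto | apply jcont_fst | exact hc]. }
  assert (ht : jcont (fun x t => vt wl wr H x (clamp T t)) x t) by (apply hF, vt_jcont; eauto).
  assert (hx : jcont (fun x t => vx wl wr H x (clamp T t)) x t) by (apply hF, vx_jcont; eauto).
  assert (hdt : jcont (fun x t => vt dwl dwr K x (clamp T t)) x t) by (apply hF, vt_jcont; eauto).
  assert (hdx : jcont (fun x t => vx dwl dwr K x (clamp T t)) x t) by (apply hF, vx_jcont; eauto).
  apply (jcont_plus
    (fun x t => dphi (vt wl wr H x (clamp T t)) * psi (vx wl wr H x (clamp T t))
                * vt dwl dwr K x (clamp T t))
    (fun x t => phi (vt wl wr H x (clamp T t)) * dpsi (vx wl wr H x (clamp T t))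
                * vx dwl dwr K x (clamp T t))).
  - apply (jcont_mult (fun x t => dphi (vt wl wr H x (clamp T t)) * psi (vx wl wr H x (clamp T t)))
             (fun x t => vt dwl dwr K x (clamp T t))); [|exact hdt].
    apply (jcont_mult (fun x t => dphi (vt wl wr H x (clamp T t)))
             (fun x t => psi (vx wl wr H x (clamp T t)))).
    + apply (jcont_comp1 dphi (fun x t => vt wl wr H x (clamp T t))); eauto.
    + apply (jcont_comp1 psi (fun x t => vx wl wr H x (clamp T t))); eauto.
  - apply (jcont_mult (fun x t => phi (vt wl wr H x (clamp T t)) * dpsi (vx wl wr H x (clamp T t)))
             (fun x t => vx dwl dwr K x (clamp T t))); [|exact hdx].
    apply (jcont_mult (fun x t => phi (vt wl wr H x (clamp T t)))
             (fun x t => dpsi (vx wl wr H x (clamp T t)))).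
    + apply (jcont_comp1 phi (fun x t => vt wl wr H x (clamp T t))); eauto.
    + apply (jcont_comp1 dpsi (fun x t => vx wl wr H x (clamp T t))); eauto.
Qed.

Lemma admissible_step H K : admissible H K -> admissible (source H) (dsource H K).
Proof.
  intros (hH & hK & hd & hb & hb').
  split; [|split; [|split; [|split]]].
  - now apply source_jcont.
  - now apply dsource_jcont.
  (* Only x is differentiated, so the clamped time is a mere parameter and its corners do no
     harm. *)
  - intros x t. unfold source. evar_last.
    + apply: is_derive_mult.
      * apply (is_derive_comp phi (fun y => vt wl wr H y (clamp T t))); [apply hphi|].
        now apply (vt_is_derive_x wl wr dwl dwr H K).
      * apply (is_derive_comp psi (fun y => vx wl wr H y (clamp T t))); [apply hpsi|].
        now apply (vx_is_derive_x wl wr dwl dwr H K).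
      * intros; apply Rmult_comm.
    + rewrite /dsource /scal /plus /= /mult /=. ring.
  - intros x t. unfold source. rewrite Rabs_mult.
    destruct (velocity_bound H x t hH hb). apply Rmult_le_compat; auto using Rabs_pos.
  - intros x t. unfold dsource.
    destruct (velocity_bound H x t hH hb) as [h1 h2].
    destruct (dvelocity_bound K x t hK hb') as [h3 h4].
    revert h1 h2 h3 h4.
    generalize (vt wl wr H x (clamp T t)) (vx wl wr H x (clamp T t))
      (vt dwl dwr K x (clamp T t)) (vx dwl dwr K x (clamp T t)).
    intros a b a1 b1 h1 h2 h3 h4.
    eapply Rle_trans; [apply Rabs_triang|]. rewrite !Rabs_mult.
    replace (2 * Lam * D0) with (A' * B * (2 * D0) + A * B' * (2 * D0)) by (unfold Lam; ring).
    apply Rplus_le_compat; (apply Rmult_le_compat;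
      [apply Rmult_le_pos; apply Rabs_pos | apply Rabs_pos | | assumption]);
      apply Rmult_le_compat; auto using Rabs_pos.
Qed.

(** The contraction: the velocities differ by at most T * e because the data cancel, and [Lam] times
    this is at most e / 2. *)
Lemma source_minus_bound H H' e x t :
  (forall x t, jcont H x t) -> (forall x t, Rabs (H x t) <= A * B) ->
  (forall x t, jcont H' x t) -> (forall x t, Rabs (H' x t) <= A * B) ->
  (forall x t, Rabs (H x t - H' x t) <= e) ->
  Rabs (source H x t - source H' x t) <= e / 2.
Proof.
  intros hH hb hH' hb' he. unfold source.
  destruct (velocity_bound H x t hH hb) as [h1 h2].
  destruct (velocity_bound H' x t hH' hb') as [h3 h4].
  destruct (vt_vx_minus_bound wl wr H H' T e x (clamp T t) hH hH' he (clamp_range T t hT)) as [h5 h6].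
  assert (e0 : 0 <= e) by (eapply Rle_trans; [apply Rabs_pos | apply (he 0 0)]).
  set (a := vt wl wr H x (clamp T t)) in *. set (a' := vt wl wr H' x (clamp T t)) in *.
  set (b := vx wl wr H x (clamp T t)) in *. set (b' := vx wl wr H' x (clamp T t)) in *.
  assert (h7 := lipschitz_of_derive_bound phi dphi A' r a a' hphi hA' h1 h3).
  assert (h8 := lipschitz_of_derive_bound psi dpsi B' r b b' hpsi hB' h2 h4).
  replace (phi a * psi b - phi a' * psi b')
    with ((phi a - phi a') * psi b + phi a' * (psi b - psi b')) by ring.
  eapply Rle_trans; [apply Rabs_triang|]. rewrite !Rabs_mult.
  apply Rle_trans with ((A' * (T * e)) * B + A * (B' * (T * e))).
  - apply Rplus_le_compat; apply Rmult_le_compat; auto using Rabs_pos;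
    (eapply Rle_trans; [eassumption|]); apply Rmult_le_compat_l; auto.
  - assert (e * (T * Lam) <= e * (1 / 2)) by (apply Rmult_le_compat_l; auto).
    unfold Lam in *. lra.
Qed.

Lemma dsource_minus_bound : forall eta, 0 < eta -> exists d, 0 < d /\
  forall H K H' K' e x t, admissible H K -> admissible H' K' ->
    (forall x t, Rabs (H x t - H' x t) <= d) ->
    (forall x t, Rabs (K x t - K' x t) <= e) ->
    Rabs (dsource H K x t - dsource H' K' x t) <= eta + e / 2.
Proof.
  intros eta heta.
  (* Each of the two coefficient errors is multiplied by a differentiated velocity of size at most 2
     * D0; the summand 4 keeps the denominator positive when D0 = 0. *)
  assert (he' : 0 < eta / (4 * D0 + 4)) by (apply Rdiv_lt_0_compat; lra).
  destruct (uniform_continuity_2d (fun a b => dphi a * psi b) (-r) r (-r) r) with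
    (eps := mkposreal _ he') as [d1 hd1].
  { intros a b _ _. apply jcont_2d.
    apply (jcont_mult (fun a _ => dphi a) (fun _ b => psi b)).
    - apply (jcont_comp1 dphi (fun a _ => a)); [auto | apply jcont_fst].
    - apply (jcont_comp1 psi (fun _ b => b)); [eauto | apply jcont_snd]. }
  destruct (uniform_continuity_2d (fun a b => phi a * dpsi b) (-r) r (-r) r) with
    (eps := mkposreal _ he') as [d2 hd2].
  { intros a b _ _. apply jcont_2d.
    apply (jcont_mult (fun a _ => phi a) (fun _ b => dpsi b)).
    - apply (jcont_comp1 phi (fun a _ => a)); [eauto | apply jcont_fst].
    - apply (jcont_comp1 dpsi (fun _ b => b)); [auto | apply jcont_snd]. }
  simpl in hd1, hd2.
  set (d0 := Rmin d1 d2).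
  assert (hd0 : 0 < d0) by (apply Rmin_pos; apply cond_pos).
  assert (hm1 : d0 <= d1) by apply Rmin_l.
  assert (hm2 : d0 <= d2) by apply Rmin_r.
  (* The velocities then differ by at most T times this, which is strictly below [d0], also for T =
     0. *)
  exists (d0 / (2 * (T + 1))).
  assert (hdpos : 0 < d0 / (2 * (T + 1))) by (apply Rdiv_lt_0_compat; lra).
  split; [exact hdpos|].
  assert (hTd : T * (d0 / (2 * (T + 1))) < d0).
  { assert (h : d0 / (2 * (T + 1)) * (2 * (T + 1)) = d0) by (field; lra). nra. }
  intros H K H' K' e x t (hH & hK & _ & hb & hbK) (hH' & hK' & _ & hb' & hbK') hd he.
  unfold dsource.
  destruct (velocity_bound H x t hH hb) as [h1 h2].
  destruct (velocity_bound H' x t hH' hb') as [h3 h4].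
  destruct (dvelocity_bound K x t hK hbK) as [h5 h6].
  destruct (vt_vx_minus_bound wl wr H H' T _ x (clamp T t) hH hH' hd (clamp_range T t hT)) as [h7 h8].
  destruct (vt_vx_minus_bound dwl dwr K K' T _ x (clamp T t) hK hK' he (clamp_range T t hT)) as [h9 h10].
  assert (e0 : 0 <= e) by (eapply Rle_trans; [apply Rabs_pos | apply (he 0 0)]).
  set (a := vt wl wr H x (clamp T t)) in *. set (a' := vt wl wr H' x (clamp T t)) in *.
  set (b := vx wl wr H x (clamp T t)) in *. set (b' := vx wl wr H' x (clamp T t)) in *.
  set (da := vt dwl dwr K x (clamp T t)) in *. set (da' := vt dwl dwr K' x (clamp T t)) in *.
  set (db := vx dwl dwr K x (clamp T t)) in *. set (db' := vx dwl dwr K' x (clamp T t)) in *.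
  clearbody a a' b b' da da' db db'.
  assert (u1 := hA _ h3). assert (u2 := hA' _ h3).
  assert (u3 := hB _ h4). assert (u4 := hB' _ h4).
  apply Rabs_le_between in h1. apply Rabs_le_between in h2.
  apply Rabs_le_between in h3. apply Rabs_le_between in h4.
  assert (P := hd1 a' b' a b h3 h4 h1 h2 ltac:(lra) ltac:(lra)).
  assert (Q := hd2 a' b' a b h3 h4 h1 h2 ltac:(lra) ltac:(lra)).
  (* Variation of the coefficients against the velocities of [K], plus the primed coefficients
     against the difference of the velocities: the [eta] part and the e / 2 part. *)
  replace (dphi a * psi b * da + phi a * dpsi b * db - (dphi a' * psi b' * da' + phi a' * dpsi b' * db'))
    with (((dphi a * psi b - dphi a' * psi b') * da + (phi a * dpsi b - phi a' * dpsi b') * db)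
      + (dphi a' * psi b' * (da - da') + phi a' * dpsi b' * (db - db'))) by ring.
  eapply Rle_trans; [apply Rabs_triang|].
  apply Rplus_le_compat.
  - eapply Rle_trans; [apply Rabs_triang|]. rewrite !Rabs_mult.
    set (c := eta / (4 * D0 + 4)) in *.
    assert (hc : c * (4 * D0 + 4) = eta) by (unfold c; field; lra).
    assert (Rabs (dphi a * psi b - dphi a' * psi b') * Rabs da <= c * (2 * D0))
      by (apply Rmult_le_compat; auto using Rabs_pos, Rlt_le).
    assert (Rabs (phi a * dpsi b - phi a' * dpsi b') * Rabs db <= c * (2 * D0))
      by (apply Rmult_le_compat; auto using Rabs_pos, Rlt_le).
    lra.
  - eapply Rle_trans; [apply Rabs_triang|]. rewrite !Rabs_mult.
    assert (Rabs (dphi a') * Rabs (psi b') * Rabs (da - da') <= A' * B * (T * e)).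
    { apply Rmult_le_compat; auto using Rabs_pos, Rmult_le_pos.
      apply Rmult_le_compat; auto using Rabs_pos. }
    assert (Rabs (phi a') * Rabs (dpsi b') * Rabs (db - db') <= A * B' * (T * e)).
    { apply Rmult_le_compat; auto using Rabs_pos, Rmult_le_pos.
      apply Rmult_le_compat; auto using Rabs_pos. }
    assert (e * (T * Lam) <= e * (1 / 2)) by (apply Rmult_le_compat_l; auto).
    unfold Lam in *. lra.
Qed.

Fixpoint picard (n : nat) : (R -> R -> R) * (R -> R -> R) :=
  match n with
  | O => (fun _ _ => 0, fun _ _ => 0)
  | S n => (source (fst (picard n)), dsource (fst (picard n)) (snd (picard n)))
  end.

Lemma picard_admissible n : admissible (fst (picard n)) (snd (picard n)).
Proof.
  induction n as [|n IH]; [|now apply admissible_step].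
  simpl. split; [|split; [|split; [|split]]]; intros x t.
  - apply jcont_const.
  - apply jcont_const.
  - apply: is_derive_const.
  - rewrite Rabs_R0. auto using Rmult_le_pos.
  - rewrite Rabs_R0. assert (0 <= Lam) by (apply Rplus_le_le_0_compat; auto using Rmult_le_pos).
    apply Rmult_le_pos; lra.
Qed.

(** [k] counts the contractions applied to two arbitrary iterates, which start at distance at most 2
    * (A * B), the diameter of the ball. No geometric series has to be summed. *)
Lemma picard_source_cauchy k n m x t :
  Rabs (fst (picard (k + n)) x t - fst (picard (k + m)) x t) <= 2 * (A * B) * (1 / 2) ^ k.
Proof.
  revert x t. induction k as [|k IH]; intros x t.
  - simpl. rewrite Rmult_1_r.
    destruct (picard_admissible n) as (_ & _ & _ & h & _). assert (h1 := h x t).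
    destruct (picard_admissible m) as (_ & _ & _ & h' & _). assert (h2 := h' x t).
    apply Rabs_le_between in h1. apply Rabs_le_between in h2. apply Rabs_le_between. lra.
  - replace (2 * (A * B) * (1 / 2) ^ S k) with (2 * (A * B) * (1 / 2) ^ k / 2) by (simpl; field).
    destruct (picard_admissible (k + n)) as (c1 & _ & _ & b1 & _).
    destruct (picard_admissible (k + m)) as (c2 & _ & _ & b2 & _).
    now apply source_minus_bound.
Qed.

Lemma picard_source_uniform_cauchy e : 0 < e -> exists N, forall n m, (N <= n)%nat -> (N <= m)%nat ->
  forall x t, Rabs (fst (picard n) x t - fst (picard m) x t) <= e.
Proof.
  intros he. destruct (half_pow_small (2 * (A * B)) e he) as [k hk].
  exists k. intros n m hn hm x t. eapply Rle_trans; [|exact hk].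
  replace n with (k + (n - k))%nat by lia. replace m with (k + (m - k))%nat by lia.
  apply picard_source_cauchy.
Qed.

(* Only continuity of [dphi] and [dpsi] is available, so successive
   differences need not be summable; comparing two arbitrary late iterates
   replaces the geometric series. *)
Lemma picard_dsource_uniform_cauchy e : 0 < e -> exists N, forall n m, (N <= n)%nat -> (N <= m)%nat ->
  forall x t, Rabs (snd (picard n) x t - snd (picard m) x t) <= e.
Proof.
  intros he.
  destruct (dsource_minus_bound (e / 4) ltac:(lra)) as [d [hd hK]].
  destruct (picard_source_uniform_cauchy d hd) as [N hN].
  set (D := 2 * Lam * D0) in *.
  (* With eta = e / 4 the error evolves by y -> e / 4 + y / 2, whose fixed point is e / 2; the
     initial excess, at most 2 * D, is halved at each step. *)
  assert (hk : forall k n m, (N <= n)%nat -> (N <= m)%nat -> forall x t,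
    Rabs (snd (picard (k + n)) x t - snd (picard (k + m)) x t) <= e / 2 + 2 * D * (1 / 2) ^ k).
  { induction k as [|k IH]; intros n m hn hm x t.
    - simpl.
      destruct (picard_admissible n) as (_ & _ & _ & _ & h). assert (h1 := h x t).
      destruct (picard_admissible m) as (_ & _ & _ & _ & h'). assert (h2 := h' x t).
      fold D in h1, h2.
      apply Rabs_le_between in h1. apply Rabs_le_between in h2. apply Rabs_le_between. lra.
    - eapply Rle_trans.
      + apply (hK _ _ _ _ (e / 2 + 2 * D * (1 / 2) ^ k) x t
                 (picard_admissible (k + n)) (picard_admissible (k + m))).
        * apply hN; lia.
        * now apply IH.
      + simpl. lra. }
  destruct (half_pow_small (2 * D) (e / 2) ltac:(lra)) as [k hke].
  exists (k + N)%nat. intros n m hn hm x t.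
  replace n with (k + (n - k))%nat by lia. replace m with (k + (m - k))%nat by lia.
  assert (h := hk k (n - k)%nat (m - k)%nat ltac:(lia) ltac:(lia) x t). lra.
Qed.

Lemma source_fixed_point : exists H K : R -> R -> R,
  (forall x t, jcont H x t) /\ (forall x t, jcont K x t) /\
  (forall x t, is_derive (fun y => H y t) x (K x t)) /\
  (forall x t, H x t = source H x t).
Proof.
  destruct (uniform_cauchy_limit (fun n => fst (picard n)) picard_source_uniform_cauchy) as [H hH].
  destruct (uniform_cauchy_limit (fun n => snd (picard n)) picard_dsource_uniform_cauchy) as [K hK].
  exists H, K.
  assert (cH : forall x t, jcont H x t).
  { apply (uniform_limit_jcont (fun n => fst (picard n))); [|exact hH].
    intros n. destruct (picard_admissible n) as (h & _). exact h. }
  assert (cK : forall x t, jcont K x t).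
  { apply (uniform_limit_jcont (fun n => snd (picard n))); [|exact hK].
    intros n. destruct (picard_admissible n) as (_ & h & _). exact h. }
  split; [exact cH | split; [exact cK | split]].
  - apply (uniform_limit_is_derive (fun n => fst (picard n)) (fun n => snd (picard n))); auto.
    intros n. destruct (picard_admissible n) as (_ & _ & h & _). exact h.
  (* The limit must stay in the closed ball before [source_minus_bound] can be applied to it. *)
  - assert (bH : forall x t, Rabs (H x t) <= A * B).
    { intros x t. apply le_epsilon. intros e he. destruct (hH e he) as [N hN].
      destruct (picard_admissible N) as (_ & _ & _ & h & _).
      assert (h1 := h x t). assert (h2 := hN N ltac:(lia) x t).
      apply Rabs_le_between in h1. apply Rabs_le_between in h2. apply Rabs_le_between. lra. }
    intros x t. apply Rminus_diag_uniq. apply cond_eq. intros e he. rewrite Rminus_0_r.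
    (* Iterate N + 1 is within e / 2 of [H] and, by the contraction, within e / 4 of [source H]. *)
    destruct (hH (e / 2) ltac:(lra)) as [N hN].
    destruct (picard_admissible N) as (c & _ & _ & b & _).
    assert (h1 := hN (S N) ltac:(lia) x t). simpl in h1.
    assert (h2 := source_minus_bound (fst (picard N)) H (e / 2) x t c b cH bH (hN N ltac:(lia))).
    apply Rabs_le_between in h1. apply Rabs_le_between in h2. apply Rabs_lt_between. lra.
Qed.

End Picard.

(** * Reconstruction of the solution *)

Lemma solution_of_source (u0 wl wr dwl dwr : R -> R) (H K : R -> R -> R) :
  (forall x, is_derive u0 x ((wl x - wr x) / 2)) ->
  (forall x, is_derive wl x (dwl x)) -> (forall x, is_derive wr x (dwr x)) ->
  (forall x, continuous dwl x) -> (forall x, continuous dwr x) ->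
  (forall x t, jcont H x t) -> (forall x t, jcont K x t) ->
  (forall x t, is_derive (fun y => H y t) x (K x t)) ->
  exists u, C2RR u /\ dt u = vt wl wr H /\ dx u = vx wl wr H /\
    (forall x t, dt (dt u) x t - dx (dx u) x t = H x t) /\
    (forall x, u x 0 = u0 x).
Proof.
  intros hu0 hwl hwr hdwl hdwr hH hK hd.
  assert (cwl : forall x, continuous wl x) by (intros x; apply: ex_derive_continuous; eexists; apply hwl).
  assert (cwr : forall x, continuous wr x) by (intros x; apply: ex_derive_continuous; eexists; apply hwr).
  set (a := vt wl wr H). set (b := vx wl wr H).
  set (da := vt dwl dwr K). set (db := vx dwl dwr K).
  assert (ca : forall x t, jcont a x t) by now apply vt_jcont.
  assert (cb : forall x t, jcont b x t) by now apply vx_jcont.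
  assert (cda : forall x t, jcont da x t) by now apply vt_jcont.
  assert (cdb : forall x t, jcont db x t) by now apply vx_jcont.
  assert (ax : forall x t, is_derive (fun y => a y t) x (da x t))
    by (intros; now apply vt_is_derive_x).
  assert (bx : forall x t, is_derive (fun y => b y t) x (db x t))
    by (intros; now apply vx_is_derive_x).
  assert (at' : forall x t, is_derive (fun s => a x s) t (H x t + db x t))
    by (intros; now apply (vt_is_derive_t wl wr dwl dwr H K)).
  assert (bt : forall x t, is_derive (fun s => b x s) t (da x t))
    by (intros; now apply (vx_is_derive_t wl wr dwl dwr H K)).
  (* Slope 0: u is the time integral of [a], so u_t = a is immediate and u_x = b is what needs an
     argument. *)
  set (u := fun x t => u0 x + duhamel 0 a x t).
  assert (ut : forall x t, is_derive (fun s => u x s) t (a x t)).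
  { intros x t. unfold u. evar_last.
    - apply: is_derive_plus; [apply: is_derive_const | apply (duhamel_is_derive_t 0 a da); auto].
    - rewrite /plus /zero /=. ring. }
  assert (ux : forall x t, is_derive (fun y => u y t) x (b x t)).
  { intros x t. unfold u. evar_last.
    - apply: is_derive_plus; [apply hu0 | apply (duhamel_is_derive_x 0 a da); auto].
    (* By compatibility [da], the x-derivative of [a], is also the t-derivative of [b]; its integral
       is b(x, t) - b(x, 0), and the last term cancels against the derivative of [u0]. *)
    - assert (hi : is_RInt (fun s => da x s) 0 t (minus (b x t) (b x 0))).
      { apply (is_RInt_derive (V := R_CompleteNormedModule) (fun s => b x s)).
        - intros s _. apply bt.
        - intros s _. apply (jcont_section da (fun _ => x) (fun s => s)); auto.
          + apply continuous_const.
          + apply continuous_id. }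
      assert (hb0 : b x 0 = (wl x - wr x) / 2).
      { unfold b, vx, wave. rewrite !duhamel_at_0.
        rewrite !Rmult_0_r !Rplus_0_r.
        field. }
      unfold duhamel.
      rewrite (RInt_ext _ (fun s => da x s)).
      2:{ intros s _. f_equal. ring. }
      rewrite (is_RInt_unique _ _ _ _ hi) hb0 /plus /minus /= /opp /plus /=. ring. }
  (* Equalities of functions rather than of values, so that they can be rewritten under a second
     [dx] or [dt]. *)
  assert (Eut : dt u = a).
  { apply functional_extensionality; intros x. apply functional_extensionality; intros t.
    apply is_derive_unique, ut. }
  assert (Eux : dx u = b).
  { apply functional_extensionality; intros x. apply functional_extensionality; intros t.
    apply is_derive_unique, ux. }
  assert (Eax : dx a = da).
  { apply functional_extensionality; intros x. apply functional_extensionality; intros t.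
    apply is_derive_unique, ax. }
  assert (Ebx : dx b = db).
  { apply functional_extensionality; intros x. apply functional_extensionality; intros t.
    apply is_derive_unique, bx. }
  assert (Eat : dt a = fun x t => H x t + db x t).
  { apply functional_extensionality; intros x. apply functional_extensionality; intros t.
    apply is_derive_unique, at'. }
  assert (Ebt : dt b = da).
  { apply functional_extensionality; intros x. apply functional_extensionality; intros t.
    apply is_derive_unique, bt. }
  exists u. split; [|split; [exact Eut | split; [exact Eux | split]]].
  - intros x t. rewrite Eux Eut Eax Ebx Eat Ebt.
    repeat split; try (eexists; eauto; fail); auto.
    + apply (jcont_plus (fun x _ => u0 x) (duhamel 0 a)).
      * apply (jcont_comp1 u0 (fun x _ => x)); [|apply jcont_fst].
        intros y. apply: ex_derive_continuous. eexists. apply hu0.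
      * now apply duhamel_jcont.
    + now apply (jcont_plus H db).
  - intros x t. rewrite Eux Eut Ebx Eat. ring.
  - intros x. unfold u. rewrite duhamel_at_0. ring.
Qed.

(** * The powers [|x|^s] *)

Lemma nnpow_pos a s : 0 < a -> nnpow a s = Rpower a s.
Proof. intros ha. unfold nnpow. destruct (Rle_dec a 0); [lra | reflexivity]. Qed.

Lemma nnpow_0 s : nnpow 0 s = 0.
Proof. unfold nnpow. destruct (Rle_dec 0 0); [reflexivity | lra]. Qed.

Lemma nnpow_abs_bound s r x : 0 <= s -> 0 < r -> Rabs x <= r ->
  Rabs (nnpow (Rabs x) s) <= Rpower r s.
Proof.
  intros hs hr hx. assert (h := exp_pos (s * ln r)). unfold nnpow.
  destruct (Rle_dec (Rabs x) 0) as [h0|h0].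
  - rewrite Rabs_R0. now apply Rlt_le.
  - rewrite Rabs_pos_eq; [|apply Rlt_le, exp_pos].
    apply Rle_Rpower_l; lra.
Qed.

(* [s |x|^(s-1) sgn x], written so that it vanishes at 0. *)
Definition dnnpow (s x : R) : R := s * (x * nnpow (Rabs x) (s - 2)).

(** It is used with s - 2, possibly negative; the convention 0^s = 0 for every real s carries the
    identity through x = 0. *)
Lemma Rabs_mult_nnpow s x : Rabs (x * nnpow (Rabs x) s) = nnpow (Rabs x) (s + 1).
Proof.
  destruct (Req_dec x 0) as [->|hx].
  - rewrite Rabs_R0 !nnpow_0 Rmult_0_l. apply Rabs_R0.
  - assert (h := Rabs_pos_lt x hx). rewrite !nnpow_pos // Rabs_mult.
    rewrite (Rabs_pos_eq (Rpower _ _)); [|apply Rlt_le, exp_pos].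
    rewrite Rpower_plus Rpower_1 //. ring.
Qed.

Lemma dnnpow_bound s r x : 1 < s -> 0 < r -> Rabs x <= r ->
  Rabs (dnnpow s x) <= s * Rpower r (s - 1).
Proof.
  intros hs hr hx. unfold dnnpow. rewrite Rabs_mult Rabs_mult_nnpow.
  rewrite (Rabs_pos_eq s); [|lra]. apply Rmult_le_compat_l; [lra|].
  replace (s - 2 + 1) with (s - 1) by ring.
  eapply Rle_trans; [apply Rle_abs|]. apply nnpow_abs_bound; lra.
Qed.

Lemma nnpow_abs_small s e : 0 < s -> 0 < e ->
  exists d : posreal, forall x, Rabs x < d -> nnpow (Rabs x) s < e.
Proof.
  intros hs he.
  assert (hd : 0 < Rpower e (/ s)) by apply exp_pos.
  exists (mkposreal _ hd). intros x hx. simpl in hx. unfold nnpow.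
  destruct (Rle_dec (Rabs x) 0) as [h0|h0]; [lra|].
  replace e with (Rpower (Rpower e (/ s)) s).
  - apply Rlt_Rpower_l; [lra|]. lra.
  - rewrite Rpower_mult Rinv_l; [|lra]. now apply Rpower_1.
Qed.

Lemma nnpow_abs_locally s x : x <> 0 ->
  locally x (fun y => Rpower (Rabs y) s = nnpow (Rabs y) s).
Proof.
  intros hx. assert (h := Rabs_pos_lt x hx).
  exists (mkposreal _ h). intros y hy.
  symmetry. apply nnpow_pos, Rabs_pos_lt. intros ->.
  unfold ball in hy; simpl in hy; unfold AbsRing_ball, abs, minus, plus, opp in hy; simpl in hy.
  rewrite Rplus_0_l Rabs_Ropp in hy. lra.
Qed.

Lemma is_derive_Rpower_abs s x : x <> 0 ->
  is_derive (fun y => Rpower (Rabs y) s) x (s * (x * Rpower (Rabs x) (s - 2))).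
Proof.
  intros hx. assert (h := Rabs_pos_lt x hx). evar_last.
  - apply (is_derive_comp (fun y => Rpower y s) Rabs).
    + apply is_derive_Reals. now apply derivable_pt_lim_power.
    + apply (is_derive_Rabs (fun y => y)); [apply: is_derive_id | exact hx].
  - rewrite /scal /= /mult /=.
    replace (s - 1) with (1 + (s - 2)) by ring.
    rewrite Rpower_plus Rpower_1 // /one /=.
    destruct (Rtotal_order x 0) as [h1|[h1|h1]]; [|lra|].
    + rewrite (sign_eq_m1 _ h1) (Rabs_left _ h1). ring.
    + rewrite (sign_eq_1 _ h1) (Rabs_pos_eq _ (Rlt_le _ _ h1)). ring.
Qed.

(** At 0 the difference quotient has modulus |h|^(s-1), which tends to 0 because s > 1; elsewhere
    |y|^s agrees locally with a smooth power. *)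
Lemma is_derive_nnpow_abs s x : 1 < s ->
  is_derive (fun y => nnpow (Rabs y) s) x (dnnpow s x).
Proof.
  intros hs. destruct (Req_dec x 0) as [->|hx].
  - replace (dnnpow s 0) with 0 by (unfold dnnpow; ring).
    apply is_derive_Reals. intros e he.
    destruct (nnpow_abs_small (s - 1) e) as [d hd]; [lra | lra |].
    exists d. intros h h0 hh.
    rewrite Rplus_0_l Rabs_R0 nnpow_0 !Rminus_0_r.
    unfold Rdiv. rewrite Rabs_mult Rabs_inv.
    replace s with (s - 1 + 1) by ring.
    rewrite -Rabs_mult_nnpow Rabs_Rabsolu Rabs_mult.
    assert (hp := Rabs_pos_lt h h0).
    replace (Rabs h * Rabs (nnpow (Rabs h) (s - 1)) * / Rabs h)
      with (Rabs (nnpow (Rabs h) (s - 1))) by (field; lra).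
    rewrite Rabs_pos_eq; [now apply hd|].
    rewrite nnpow_pos //. apply Rlt_le, exp_pos.
  - apply (is_derive_ext_loc (fun y => Rpower (Rabs y) s)); [now apply nnpow_abs_locally|].
    unfold dnnpow. rewrite nnpow_pos; [|now apply Rabs_pos_lt].
    now apply is_derive_Rpower_abs.
Qed.

Lemma continuous_dnnpow s x : 1 < s -> continuous (dnnpow s) x.
Proof.
  intros hs. destruct (Req_dec x 0) as [->|hx].
  - apply continuity_pt_filterlim. intros e he.
    destruct (nnpow_abs_small (s - 1) (e / s)) as [d hd]; [lra | apply Rdiv_lt_0_compat; lra |].
    exists d. split; [apply cond_pos|]. intros y [_ hy].
    simpl in *. unfold Rdist in *. rewrite Rminus_0_r in hy.
    replace (dnnpow s y - dnnpow s 0) with (s * (y * nnpow (Rabs y) (s - 2)))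
      by (unfold dnnpow; ring).
    rewrite Rabs_mult Rabs_mult_nnpow. replace (s - 2 + 1) with (s - 1) by ring.
    rewrite Rabs_pos_eq; [|lra].
    assert (h := hd y hy). apply Rlt_div_r in h; lra.
  - unfold dnnpow. apply: continuous_mult; [apply continuous_const|].
    apply: continuous_mult; [apply continuous_id|].
    apply (continuous_ext_loc _ (fun y => Rpower (Rabs y) (s - 2)));
      [now apply nnpow_abs_locally|].
    apply: ex_derive_continuous. eexists. now apply is_derive_Rpower_abs.
Qed.

(** * Bounds for compactly supported data, and the choice of constants *)

Lemma supp_in_Derive h R0 : supp_in h R0 -> supp_in (Derive h) R0.
Proof.
  intros hs x hx. apply is_derive_unique.
  apply (is_derive_ext_loc (fun _ => 0)); [|apply: is_derive_const].
  assert (hp : 0 < Rabs x - R0) by lra.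
  exists (mkposreal _ hp). intros y hy. symmetry. apply hs.
  unfold ball in hy; simpl in hy; unfold AbsRing_ball, abs, minus, plus, opp in hy; simpl in hy.
  assert (ht := Rabs_triang_inv x y). rewrite Rabs_minus_sym in ht.
  unfold Rminus in ht. lra.
Qed.

Lemma supp_in_bounded h R0 : 0 <= R0 -> (forall x, continuous h x) -> supp_in h R0 ->
  exists M, 0 <= M /\ forall x, Rabs (h x) <= M.
Proof.
  intros hR hc hs.
  destruct (continuity_ab_maj (fun x => Rabs (h x)) (- R0) R0) as [m [hm _]]; [lra | |].
  - intros c _. apply continuity_pt_filterlim.
    apply (continuous_comp h Rabs); [apply hc | apply continuous_Rabs].
  - exists (Rabs (h m)). split; [apply Rabs_pos|]. intros x.
    destruct (Rle_dec (Rabs x) R0) as [hx|hx].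
    + apply hm. now apply Rabs_le_between.
    + rewrite hs; [|lra]. rewrite Rabs_R0. apply Rabs_pos.
Qed.

Theorem theorem2p1 (p q : R) (f g : R -> R) (R0 : R) :
  1 < p -> 1 < q -> 1 <= R0 ->
  C2R f -> C1R g -> supp_in f R0 -> supp_in g R0 ->
  exists eps0 c : R, 0 < eps0 /\ 0 < c /\
    forall eps : R, 0 < eps <= eps0 ->
      forall T : R, 0 < T -> T <= c * Rpower eps (- (p + q - 1)) ->
        exists u : R -> R -> R, classical_solution p q eps f g T u.
Proof.
  intros hp hq hR hf hg sf sg.
  assert (df : forall x, is_derive f x (Derive f x)) by (intros x; apply Derive_correct, hf).
  assert (ddf : forall x, is_derive (Derive f) x (Derive (Derive f) x))
    by (intros x; apply Derive_correct, hf).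
  assert (cddf : forall x, continuous (Derive (Derive f)) x) by (intros x; apply hf).
  assert (dg : forall x, is_derive g x (Derive g x)) by (intros x; apply Derive_correct, hg).
  assert (cdg : forall x, continuous (Derive g) x) by (intros x; apply hg).
  assert (R0_pos : 0 <= R0) by lra.
  destruct (supp_in_bounded (Derive f) R0) as [M1 [M1_pos hM1]]; auto using supp_in_Derive.
  { intros x. apply: ex_derive_continuous. eexists; apply ddf. }
  destruct (supp_in_bounded g R0) as [M2 [M2_pos hM2]]; auto.
  { intros x. apply: ex_derive_continuous. eexists; apply dg. }
  destruct (supp_in_bounded (Derive (Derive f)) R0) as [N1 [N1_pos hN1]]; auto using supp_in_Derive.
  destruct (supp_in_bounded (Derive g) R0) as [N2 [N2_pos hN2]]; auto using supp_in_Derive.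
  (* The summand 1 keeps the radius [r] positive even for vanishing data, as [Rpower] requires. *)
  set (M := M1 + M2 + 1).
  assert (hM : 0 < M) by (unfold M; lra).
  (* Everything in 2 * (p + q) * r^(p+q-1) except the power of eps, for r = 2 * M * eps. The powers
     are homogeneous, so eps factors out exactly. *)
  set (C := 2 * (p + q) * Rpower (2 * M) (p + q - 1)).
  assert (hC : 0 < C).
  { apply Rmult_lt_0_compat; [lra | apply exp_pos]. }
  exists 1, (/ C). split; [lra|]. split; [now apply Rinv_0_lt_compat|].
  intros eps [heps _] T hT hTle.
  (* The initial invariants are at most M * eps = r / 2, leaving the other half to the Duhamel
     term. *)
  set (r := 2 * M * eps).
  assert (hr : 0 < r) by (apply Rmult_lt_0_compat; lra).
  set (P := Rpower r (p + q - 1)).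
  assert (hP : 0 < P) by apply exp_pos.
  (* The constant [Lam] of the Picard section for pure powers: both terms have degree p + q - 1 in
     r. *)
  assert (hLam : p * Rpower r (p - 1) * Rpower r q + Rpower r p * (q * Rpower r (q - 1))
                 = (p + q) * P).
  { unfold P. replace (p + q - 1) with (p - 1 + q) by ring.
    replace (Rpower r p * (q * Rpower r (q - 1))) with (q * Rpower r (p - 1 + q)).
    - rewrite Rpower_plus. ring.
    - replace (p - 1 + q) with (p + (q - 1)) by ring. rewrite Rpower_plus. ring. }
  assert (hTLam : T * ((p + q) * P) <= 1 / 2).
  { assert (hscale : P = Rpower (2 * M) (p + q - 1) * Rpower eps (p + q - 1)).
    { unfold P, r. rewrite -Rpower_mult_distr //. lra. }
    assert (hinv : Rpower eps (- (p + q - 1)) * Rpower eps (p + q - 1) = 1).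
    { rewrite -Rpower_plus Rplus_opp_l. now apply Rpower_O. }
    apply Rle_trans with (/ C * Rpower eps (- (p + q - 1)) * ((p + q) * P)).
    - apply Rmult_le_compat_r; [|exact hTle]. apply Rmult_le_pos; lra.
    - right. rewrite hscale.
      replace (/ C * Rpower eps (- (p + q - 1)) *
        ((p + q) * (Rpower (2 * M) (p + q - 1) * Rpower eps (p + q - 1))))
      with (/ C * (C / 2) * (Rpower eps (- (p + q - 1)) * Rpower eps (p + q - 1)))
        by (replace (C / 2) with ((p + q) * Rpower (2 * M) (p + q - 1)) by (unfold C; field); ring).
      rewrite hinv. field. lra. }
  set (wl := fun x => eps * (g x + Derive f x)).
  set (wr := fun x => eps * (g x - Derive f x)).
  set (dwl := fun x => eps * (Derive g x + Derive (Derive f) x)).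
  set (dwr := fun x => eps * (Derive g x - Derive (Derive f) x)).
  assert (hwl : forall x, is_derive wl x (dwl x)).
  { intros x. apply is_derive_scal. now apply: is_derive_plus. }
  assert (hwr : forall x, is_derive wr x (dwr x)).
  { intros x. apply is_derive_scal. now apply: is_derive_minus. }
  assert (hdwl : forall x, continuous dwl x).
  { intros x. apply: continuous_mult; [apply continuous_const | now apply: continuous_plus]. }
  assert (hdwr : forall x, continuous dwr x).
  { intros x. apply: continuous_mult; [apply continuous_const | now apply: continuous_minus]. }
  assert (comb : forall a b A B, Rabs a <= A -> Rabs b <= B ->
     Rabs (eps * (a + b)) <= eps * (A + B) /\ Rabs (eps * (a - b)) <= eps * (A + B)).
  { intros a b A B ha hb. apply Rabs_le_between in ha. apply Rabs_le_between in hb.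
    rewrite !Rabs_mult (Rabs_pos_eq eps (Rlt_le _ _ heps)).
    split; (apply Rmult_le_compat_l; [lra|]); apply Rabs_le_between; lra. }
  assert (hMr : eps * (M2 + M1) <= r / 2).
  { unfold r, M. nra. }
  destruct (source_fixed_point (fun x => nnpow (Rabs x) p) (dnnpow p)
    (fun x => nnpow (Rabs x) q) (dnnpow q) wl wr dwl dwr
    (Rpower r p) (p * Rpower r (p - 1)) (Rpower r q) (q * Rpower r (q - 1)) r T
    (eps * (N2 + N1))) as (H & K & cH & cK & dH & hfix); auto.
  - intros x; now apply is_derive_nnpow_abs.
  - intros x; now apply is_derive_nnpow_abs.
  - intros x; now apply continuous_dnnpow.
  - intros x; now apply continuous_dnnpow.
  - intros x hx; apply nnpow_abs_bound; lra.
  - intros x hx; now apply dnnpow_bound.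
  - intros x hx; apply nnpow_abs_bound; lra.
  - intros x hx; now apply dnnpow_bound.
  - intros x. eapply Rle_trans; [apply (comb _ _ M2 M1) | exact hMr]; auto.
  - intros x. eapply Rle_trans; [apply (comb _ _ M2 M1) | exact hMr]; auto.
  - intros x. apply (comb _ _ N2 N1); auto.
  - intros x. apply (comb _ _ N2 N1); auto.
  - lra.
  (* The hypothesis [hAB]: r^(p+q) = r * P <= r * ((p + q) * P), since p + q > 1. *)
  - rewrite hLam. rewrite -Rpower_plus. replace (p + q) with (1 + (p + q - 1)) at 1 by ring.
    rewrite Rpower_plus Rpower_1 //. fold P.
    apply Rmult_le_compat_l; [lra|]. nra.
  - now rewrite hLam.
  - destruct (solution_of_source (fun x => eps * f x) wl wr dwl dwr H K)
      as (u & hu & Et & Ex & heq & h0); auto.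
    { intros x. replace ((wl x - wr x) / 2) with (eps * Derive f x) by (unfold wl, wr; field).
      now apply is_derive_scal. }
    exists u. split; [exact hu|]. split; [|split; [exact h0|]].
    (* For 0 < t < T the clamp is the identity, so the truncated equation is the original one. *)
    + intros x t ht. rewrite heq hfix Et Ex. unfold source.
      rewrite clamp_id; [reflexivity | lra].
    + intros x. rewrite Et. unfold vt, wave. rewrite !duhamel_at_0.
      rewrite !Rmult_0_r !Rplus_0_r.
      unfold wl, wr. field.
Qed.
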